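(* Let $n > r \ge 1$ be integers. Then every edge of $\operatorname{BG}(U_{r,n})$ is contained in at least $\bigl((n-r-1)!\,(r-1)!\bigr)^{\min\{n-r-1,\,r-1\}}$ distinct Hamiltonian cycles of $\operatorname{BG}(U_{r,n})$.
   Context: The uniform matroid $U_{r,n}$ has ground set $[n]=\{1,\dots,n\}$, and its bases are all $r$-subsets of $[n]$. For a matroid $M$, its basis graph $\operatorname{BG}(M)$ has the bases of $M$ as vertices, two bases $B,B'$ being adjacent if and only if $|B\triangle B'|=2$. *)

(* Defs.v *)
From mathcomp Require Import all_boot.

Set Implicit Arguments.
Unset Strict Implicit.
Unset Printing Implicit Defensive.

Record matroid (T : finType) := Matroid {
  bases : {set {set T}};
  bases_neq0 : bases != set0;
  basis_exchange : forall B B' : {set T}, B \in bases -> B' \in bases ->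
    forall x, x \in B :\: B' ->
    exists2 y, y \in B' :\: B & y |: (B :\ x) \in bases
}.

Section Uniform.
Variables (n r : nat) (le_rn : r <= n).

Definition uniform_bases : {set {set 'I_n}} := [set B : {set 'I_n} | #|B| == r].

Lemma uniform_bases_neq0 : uniform_bases != set0.
Proof. by rewrite -card_gt0 card_draws card_ord bin_gt0. Qed.

Lemma uniform_exchange (B B' : {set 'I_n}) :
  B \in uniform_bases -> B' \in uniform_bases ->
  forall x, x \in B :\: B' ->
  exists2 y, y \in B' :\: B & y |: (B :\ x) \in uniform_bases.
Proof.
rewrite !inE => /eqP cB /eqP cB' x; rewrite inE => /andP[xB' xB].
have : 0 < #|B' :\: B|.
  have : 0 < #|B :\: B'| by apply/card_gt0P; exists x; rewrite inE xB' xB.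
  by rewrite !cardsD cB cB' setIC.
case/card_gt0P=> y; rewrite inE => /andP[yB yB'].
exists y; first by rewrite inE yB yB'.
by rewrite inE cardsU1 !inE (negPf yB) andbF -cB (cardsD1 x B) xB.
Qed.

(* The ground set [n] is rendered as 'I_n = {0, ..., n-1}. *)
Definition uniform_matroid : matroid 'I_n :=
  Matroid uniform_bases_neq0 uniform_exchange.

End Uniform.

Record sgraph := SGraph {
  vertex :> finType;
  adj : rel vertex;
  adj_sym : symmetric adj;
  adj_irrefl : irreflexive adj
}.

Definition edges (G : sgraph) : {set {set G}} :=
  [set [set p.1; p.2] | p : G * G & adj p.1 p.2].

Definition symdiff (T : finType) (A B : {set T}) : {set T} :=
  (A :\: B) :|: (B :\: A).

Section BasisGraph.
Variables (T : finType) (M : matroid T).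

Definition basis_adj : rel {B : {set T} | B \in bases M} :=
  fun B B' => #|symdiff (val B) (val B')| == 2.

Lemma basis_adj_sym : symmetric basis_adj.
Proof. by move=> B B'; rewrite /basis_adj /symdiff setUC. Qed.

Lemma basis_adj_irrefl : irreflexive basis_adj.
Proof. by move=> B; rewrite /basis_adj /symdiff setDv setU0 cards0. Qed.

Definition basis_graph : sgraph := SGraph basis_adj_sym basis_adj_irrefl.

End BasisGraph.

Definition cycle_edges (T : finType) (s : seq T) : {set {set T}} :=
  [set [set x; next s x] | x in s].

(* A Hamiltonian cycle is identified with its edge set, so that the choice of a
   starting vertex and of an orientation does not matter.  It is listed by a
   duplicate-free sequence of length #|G|, hence through all the vertices.

   On at least 3 vertices this is the usual notion.  On 2 vertices, the closed
   walk u, v, u counts: its edge set is the single edge {u, v}, so K_2 has one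
   Hamiltonian cycle.  Among the graphs BG(U_{r,n}) with 1 <= r < n, this
   concerns only BG(U_{1,2}) = K_2; the bound in the theorem equals 1 there. *)
Definition hamiltonian_cycles (G : sgraph) : {set {set {set G}}} :=
  [set cycle_edges s | s : #|G|.-tuple G & ucycleb (@adj G) s].

(* Main.v *)
Require Import Defs.
From mathcomp Require Import all_boot zify.

(* Hamiltonian cycles through an edge {X, Y} correspond to Hamiltonian paths
   from X to Y.  Let F(a, b) be the least number of such paths, over the edges
   {X, Y}, in the graph of the k-sets between K and L, where k = |K| + b + 1 and
   |L| = k + a + 1.  Choose z in L outside X and Y.  The k-sets avoiding z
   form a graph of type (a - 1, b), those containing z one of type (a, b - 1).
   In a Hamiltonian path from X to Y of the former, any edge PQ can be replaced
   by an edge PP', a Hamiltonian path of the latter from P' to Q', and an edge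
   Q'Q, where P' = (P n Q) + z and Q' = Q - t + z for some t in (P n Q) - K.
   The result determines all the choices made, hence
   F(a, b) >= F(a - 1, b) * (N - 1) * F(a, b - 1), where N is the number of
   k-sets avoiding z and N - 1 >= a (b + 1).  When a = 0 or b = 0 the graph is
   complete. *)

Set Implicit Arguments.
Unset Strict Implicit.

(** * Numerical estimates *)

Lemma bin_addn_lower (a m : nat) : (a * m).+1 <= 'C(a + m, m).
Proof.
elim: a m => [|a IHa] m; first by rewrite add0n binn.
elim: m => [|m IHm]; first by rewrite muln0 bin0.
rewrite addSn binS; have := IHa m.+1; have := IHm.
by rewrite addSnnS => h1 h2; nia.
Qed.

Definition edge_bound (a b : nat) := (a`! * b`!) ^ minn a b.

(** For [a < b] the left side splits off [edge_bound a.+1 b], which has the same exponent, and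
    leaves [b.+1 ^ a.+1], absorbed by the other two factors; [b < a] is symmetric. For [a = b] both
    exponents on the right are one lower, and [a! <= a! ^ a] for positive [a], with the middle
    factor, makes up for it. *)
Lemma edge_bound_rec (a b : nat) :
  edge_bound a.+1 b.+1 <=
  edge_bound a b.+1 * (a.+1 * b.+2) * edge_bound a.+1 b.
Proof.
rewrite /edge_bound !factS.
have expW x y k : x <= y -> x ^ k <= y ^ k by case: k => // k; rewrite leq_exp2r.
have [A0 B0] := (fact_gt0 a, fact_gt0 b).
move EA: (a`!) A0 => A A0; move EB: (b`!) B0 => B B0.
case: (ltngtP a b) => [ab|ab|eab].
- have -> : minn a.+1 b.+1 = a.+1 by lia.
  have -> : minn a b.+1 = a by lia.
  have -> : minn a.+1 b = a.+1 by lia.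
  have -> : a.+1 * A * (b.+1 * B) = b.+1 * (a.+1 * A * B) by lia.
  rewrite [X in X <= _]expnMn leq_mul // expnSr leq_mul //; last by nia.
  by apply: expW; nia.
- have -> : minn a.+1 b.+1 = b.+1 by lia.
  have -> : minn a b.+1 = b.+1 by lia.
  have -> : minn a.+1 b = b by lia.
  have -> : a.+1 * A * (b.+1 * B) = (A * (b.+1 * B)) * a.+1 by lia.
  rewrite [X in X <= _]expnMn -mulnA leq_mul // expnS leq_mul //; first by nia.
  by apply: expW; nia.
- move: EB; rewrite -eab EA => <-; rewrite minnn (minn_idPl (leqnSn a)) (minn_idPr (leqnSn a)).
  case: a EA eab => [<- _|a EA _]; first by rewrite !muln1.
  set p := a.+2; set m := a.+1.
  have -> : A * (p * A) = p * A * A by rewrite mulnC.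
  have AQ : A <= A ^ m by rewrite -{1}(expn1 A) leq_pexp2l.
  rewrite !expnMn (expnS p m) (expnS A m).
  set P := p ^ m; set Q := A ^ m in AQ *.
  have -> : p * P * (A * Q) * (p * P * (A * Q)) =
            P * P * (Q * Q) * (p * p) * (A * A) by lia.
  have -> : P * Q * Q * (p * p.+1) * (P * Q * Q) =
            P * P * (Q * Q) * (p * p.+1) * (Q * Q) by lia.
  by rewrite !leq_mul.
Qed.

(** * Hamiltonian paths and their splicing *)

Section HamiltonianPaths.
Variables (V : finType) (e : rel V).

(* A path is listed without its first vertex [x]. *)
Definition hampaths (A : {set V}) (x y : V) : seq (seq V) :=
  [seq p <- permutations (enum (A :\ x)) | path e x p && (last x p == y)].

Lemma hampaths_uniq (A : {set V}) (x y : V) : uniq (hampaths A x y).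
Proof. exact/filter_uniq/permutations_uniq. Qed.

Lemma hampathsP (A : {set V}) (x y : V) (p : seq V) : x \in A ->
  reflect [/\ uniq (x :: p), x :: p =i A, path e x p & last x p = y]
          (p \in hampaths A x y).
Proof.
move=> xA; rewrite mem_filter mem_permutations; apply: (iffP idP).
  move=> /andP[/andP[ep /eqP lp] pA]; split=> //=.
    by rewrite (perm_mem pA) mem_enum !inE eqxx (perm_uniq pA) enum_uniq.
  by move=> z; rewrite inE (perm_mem pA) mem_enum !inE; case: eqVneq => // ->.
case=> /andP[xp up] pA -> ->; rewrite eqxx /=.
apply: uniq_perm; rewrite ?enum_uniq // => z; rewrite mem_enum !inE -pA inE.
by case: eqVneq => // -> /=; apply: negPf.
Qed.

Lemma hampaths_size (A : {set V}) (x y : V) (p : seq V) :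
  x \in A -> p \in hampaths A x y -> #|A| = (size p).+1.
Proof.
by move=> xA /(hampathsP _ _ xA)[up pA _ _]; rewrite -(eq_card pA) (card_uniqP up).
Qed.

(** Restricting a spliced path to [A] and to [B] returns the outer and the inner path, and the
    position of its first entry in [B] marks the replaced edge; so distinct choices give distinct
    paths. *)
Lemma hampaths_splice (A B : {set V}) (x y : V) (f g : V -> V -> V) (c : nat) :
    [disjoint A & B] -> x \in A ->
    {in A &, forall u v, e u v ->
      [/\ f u v \in B, e u (f u v), e (g u v) v
        & c <= size (hampaths B (f u v) (g u v))]} ->
  size (hampaths A x y) * #|A|.-1 * c <= size (hampaths (A :|: B) x y).
Proof.
move=> dAB xA fgP.
have AB z : z \in A -> z \in B = false by move/(disjointFr dAB).
(* As [w.1] omits the start [x], edge number [w.2] runs from that entry of [x :: w.1] to that entry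
   of [w.1]. *)
pose u (w : seq V * nat) := nth x (x :: w.1) w.2.
pose v (w : seq V * nat) := nth x w.1 w.2.
pose W := [seq (p, j) | p <- hampaths A x y, j <- iota 0 #|A|.-1].
pose splice (w : seq V * nat) q :=
  take w.2 w.1 ++ (f (u w) (v w) :: q) ++ drop w.2 w.1.
pose S := [seq splice w q
  | w <- W, q <- hampaths B (f (u w) (v w)) (g (u w) (v w))].
have WP w : w \in W ->
    [/\ w.1 \in hampaths A x y, w.2 < size w.1, {subset w.1 <= A}
      & [/\ u w \in A, v w \in A & e (u w) (v w)]].
  case/allpairsP=> -[p j] /= [pH jA ->] /=.
  have sp := hampaths_size xA pH.
  move: jA; rewrite mem_iota sp /= add0n => jp.
  have [_ pA ep _] := hampathsP _ _ xA pH.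
  have sub : {subset p <= A} by move=> z zp; rewrite -pA inE zp orbT.
  split=> //; split; last by apply: (pathP x ep).
    by rewrite -pA mem_nth //= ltnS ltnW.
  by apply/sub/mem_nth.
have SP w q : w \in W -> q \in hampaths B (f (u w) (v w)) (g (u w) (v w)) ->
    [/\ filter (mem A) (splice w q) = w.1,
        filter (mem B) (splice w q) = f (u w) (v w) :: q,
        find (mem B) (splice w q) = w.2
      & splice w q \in hampaths (A :|: B) x y].
  move=> /WP[pH jp subA [uA vA euv]] qH.
  have [fB euf egv _] := fgP _ _ uA vA euv.
  have [uq qB eq lq] := hampathsP _ _ fB qH.
  have [up pA ep lp] := hampathsP _ _ xA pH.
  have noB s : {subset s <= w.1} -> filter (mem B) s = [::] /\ filter (mem A) s = s.
    move=> ss; split.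
      by apply/eqP; rewrite -(negbK (_ == _)) -has_filter; apply/hasPn=> z /ss/subA/AB /= ->.
    by apply/all_filterP/allP=> z /ss/subA.
  have [tB tA] := noB (take w.2 w.1) (@mem_take _ _ _).
  have [kB kA] := noB (drop w.2 w.1) (@mem_drop _ _ _).
  have sB z : z \in f (u w) (v w) :: q -> (z \in B) * (z \in A = false).
    by rewrite qB => zB; split=> //; apply: contraTF zB => /AB ->.
  have qfB : filter (mem B) (f (u w) (v w) :: q) = f (u w) (v w) :: q.
    by apply/all_filterP/allP=> z /sB[].
  have qfA : filter (mem A) (f (u w) (v w) :: q) = [::].
    by apply/eqP; rewrite -(negbK (_ == _)) -has_filter; apply/hasPn=> z /sB[_] /= ->.
  have mem z : (z \in splice w q) = (z \in w.1) || (z \in f (u w) (v w) :: q).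
    by rewrite !mem_cat orbCA orbC -mem_cat cat_take_drop.
  split.
  - by rewrite /splice !filter_cat tA qfA kA cat_take_drop.
  - by rewrite /splice !filter_cat tB qfB kB cats0.
  - rewrite /splice find_cat has_filter tB /= fB addn0.
    by rewrite size_takel // ltnW.
  - apply/hampathsP; first by rewrite inE xA.
    split.
    + have ps : perm_eq (x :: splice w q) ((x :: w.1) ++ (f (u w) (v w) :: q)).
        rewrite cat_cons perm_cons -[w.1 in X in perm_eq _ X](cat_take_drop w.2).
        by rewrite -catA perm_cat2l perm_catC.
      rewrite (perm_uniq ps) cat_uniq up uq andbT andTb; apply/hasPn=> z /sB[_ zA].
      by rewrite /= pA zA.
    + by move=> z; rewrite inE mem in_setU -pA -qB !in_cons !orbA.
    + have lt : last x (take w.2 w.1) = u w.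
        rewrite (last_nth x) size_takel ?(ltnW jp) //.
        exact: (nth_take x (n0 := w.2.+1) _ (x :: w.1)).
      rewrite /splice !cat_path lt /= euf eq lq.
      have := ep; rewrite -{1}(cat_take_drop w.2 w.1) cat_path => /andP[-> ].
      by rewrite (drop_nth x) //= => /andP[_ ->]; rewrite egv.
    + rewrite /splice -lp -[w.1 in RHS](cat_take_drop w.2) !last_cat.
      by rewrite (drop_nth x).
have US : uniq S.
  apply: allpairs_uniq_dep.
  - apply: allpairs_uniq; rewrite ?hampaths_uniq ?iota_uniq //.
    by move=> [? ?] [? ?].
  - by move=> w _; apply: hampaths_uniq.
  - move=> ? ? /allpairsPdep[w [q [wW qH ->]]] /allpairsPdep[w' [q' [wW' qH' ->]]].
    move=> /= eqS.
    have [] := SP _ _ wW qH; rewrite eqS.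
    have [-> -> -> _] := SP _ _ wW' qH' => w1 q1 w2 _.
    have ww : w = w' by rewrite (surjective_pairing w) -w1 -w2 -surjective_pairing.
    by case: q1 => _ ->; rewrite ww.
have sS : {subset S <= hampaths (A :|: B) x y}.
  by move=> _ /allpairsPdep[w [q [wW qH ->]]]; case: (SP _ _ wW qH).
apply: leq_trans (uniq_leq_size US sS).
have sW : size W = size (hampaths A x y) * #|A|.-1.
  by rewrite size_allpairs size_iota.
rewrite size_allpairs_dep -sW.
(* Each pair in [W] contributes at least [c] splices. *)
elim: (W) WP => //= w W' IH WP.
rewrite mulSn leq_add ?IH //; last by move=> z zW; apply: WP; rewrite inE zW orbT.
have [_ _ _ [uA vA euv]] := WP w (mem_head _ _).
by case: (fgP _ _ uA vA euv).
Qed.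

Lemma complete_path (A : {set V}) (x : V) (p : seq V) :
    {in A &, forall u v, u != v -> e u v} ->
  uniq (x :: p) -> {subset x :: p <= A} -> path e x p.
Proof.
move=> eA; elim: p x => //= z p IHp x /andP[xzp uzp] sA.
have sA' : {subset z :: p <= A} by move=> w wp; apply: sA; rewrite inE wp orbT.
rewrite IHp // andbT eA ?(sA x) ?(sA' z) ?mem_head //.
by move: xzp; rewrite inE negb_or => /andP[].
Qed.

(** Any duplicate-free listing of [A] from [x] to [y] is a path. *)
Lemma complete_hampaths (A : {set V}) (x y : V) :
    {in A &, forall u v, u != v -> e u v} -> x \in A -> y \in A -> x != y ->
  0 < size (hampaths A x y).
Proof.
move=> eA xA yA xy; pose p := rcons (enum (A :\ x :\ y)) y.
have pA : x :: p =i A.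
  move=> z; rewrite inE mem_rcons inE mem_enum !inE.
  by case: eqVneq => [->|_] //=; case: eqVneq => [->|_].
have up : uniq (x :: p).
  by rewrite /= mem_rcons rcons_uniq inE !mem_enum !inE !eqxx (negPf xy) andbF enum_uniq.
have : p \in hampaths A x y.
  apply/hampathsP => //; split; rewrite ?last_rcons //.
  by apply: (complete_path eA up) => z; rewrite pA.
by case: (hampaths A x y).
Qed.

End HamiltonianPaths.

(** * The [k]-sets between [K] and [L] *)

Section Levels.
Variable T : finType.
Implicit Types A B K L X Y : {set T}.

Definition exchange : rel {set T} := fun A B => #|symdiff A B| == 2.

(** The symmetric difference of two [k]-sets has [2 * (k - #|A :&: B|)] elements. *)
Lemma exchangeE A B k : #|A| = k -> #|B| = k -> exchange A B = (#|A :&: B|.+1 == k).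
Proof.
move=> cA cB; rewrite /exchange /symdiff cardsU.
have -> : (A :\: B) :&: (B :\: A) = set0.
  by apply/setP=> z; rewrite !inE; case: (z \in A); case: (z \in B).
have := cardsID B A; have := cardsID A B; rewrite cA cB cards0 (setIC B A).
lia.
Qed.

(** For [K \subset L] and [#|K| <= k <= #|L|], these are the bases of the minor of a uniform matroid
    that contracts [K] and deletes the complement of [L], each kept together with [K] so that the
    recursion stays over [T]. *)
Definition level K L k := [set B : {set T} | [&& K \subset B, B \subset L & #|B| == k]].

Lemma levelP K L k B :
  reflect [/\ K \subset B, B \subset L & #|B| = k] (B \in level K L k).
Proof.
by rewrite inE; apply: (iffP and3P) => -[? ? /eqP ?]; split=> //; apply/eqP.
Qed.

Lemma level_split K L k z :
  level K L k = level K (L :\ z) k :|: level (z |: K) L k.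
Proof.
apply/setP=> B; rewrite !inE subsetD1 subUset sub1set.
by case: (z \in B); rewrite /= ?andbF ?andbT ?orbF.
Qed.

(** Adding [K] identifies the [b]-subsets of [L :\: K] with this level. *)
Lemma card_level K L a b : K \subset L -> #|L| = #|K| + b + a ->
  #|level K L (#|K| + b)| = 'C(a + b, b).
Proof.
move=> KL cL; have cLK : #|L :\: K| = a + b.
  by rewrite cardsD (setIidPr KL) cL; lia.
rewrite -cLK -cards_draws; set S := [set D : {set T} | _].
rewrite -(card_in_imset (f := fun D => K :|: D) (D := S)); last first.
  move=> D D'; rewrite !inE !subsetD => /andP[/andP[_ dD] _] /andP[/andP[_ dD'] _].
  move=> /(congr1 (fun E => E :\: K)).
  rewrite !setDUl setDv !set0U.
  by move/setDidPl: dD => ->; move/setDidPl: dD' => ->.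
apply: eq_card => B; apply/levelP/imsetP.
  move=> [KB BL cB]; exists (B :\: K).
    by rewrite inE setSD //= cardsD (setIidPr KB) cB addKn.
  by rewrite setDE setUIr setUCr setIT; apply/esym/setUidPr.
move=> [D]; rewrite inE subsetD => /andP[/andP[DL dD] /eqP cD] ->.
split; rewrite ?subsetUl ?subUset ?KL //.
rewrite cardsU cD; have -> : K :&: D = set0 by apply/eqP; rewrite setI_eq0 disjoint_sym.
by rewrite cards0 subn0.
Qed.

(** Distinct [k]-sets meet in at most [k - 1] elements. Equality is forced by [K] inside the
    intersection in the first case, and by the union lying in [L] in the second. *)
Lemma level_complete K L k :
    k = #|K|.+1 \/ #|L| = k.+1 ->
  {in level K L k &, forall A B, A != B -> exchange A B}.
Proof.
move=> h A B /levelP[KA AL cA] /levelP[KB BL cB] AB.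
rewrite (exchangeE cA cB).
have IA : #|A :&: B| < k.
  rewrite -cA proper_card // properE subsetIl subsetI subxx /=.
  by apply: contra AB => sAB; rewrite eqEcard sAB cA cB leqnn.
have KI : #|K| <= #|A :&: B| by rewrite subset_leq_card // subsetI KA.
have := subset_leq_card (_ : A :|: B \subset L); rewrite subUset AL BL cardsU cA cB.
move=> /(_ isT); lia.
Qed.

Lemma level_hampaths a b K L k X Y :
    K \subset L -> k = #|K| + b.+1 -> #|L| = k + a.+1 ->
    X \in level K L k -> Y \in level K L k -> exchange X Y ->
  edge_bound a b <= size (hampaths exchange (level K L k) X Y).
Proof.
elim: a b K L k X Y => [|a IHa] b.
  move=> K L k X Y KL kE cL XL YL eXY.
  rewrite /edge_bound min0n complete_hampaths //.
    by apply: level_complete; right; lia.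
  by apply: contraTneq eXY => ->; rewrite /exchange /symdiff setDv setU0 cards0.
elim: b => [|b IHb] K L k X Y KL kE cL XL YL eXY.
  rewrite /edge_bound minn0 complete_hampaths //.
    by apply: level_complete; left; lia.
  by apply: contraTneq eXY => ->; rewrite /exchange /symdiff setDv setU0 cards0.
have [KX sXL cX] := levelP _ _ _ _ XL; have [KY sYL cY] := levelP _ _ _ _ YL.
(* [X] and [Y] cover only [k + 1] of the [k + a + 2] elements of [L]. *)
have [z zL zXY] : exists2 z, z \in L & z \notin X :|: Y.
  apply/subsetPn; apply/negP => /subset_leq_card.
  move: eXY; rewrite (exchangeE cX cY) cardsU cX cY => /eqP; lia.
have [zX zY] : z \notin X /\ z \notin Y by apply/norP; rewrite -in_setU.
have zK : z \notin K by apply: contra zX; apply: subsetP.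
(* For adjacent [P] and [Q] the default [z] is never taken: [P :&: Q] has [k - 1 = #|K| + b + 1]
   elements, more than [K]. *)
pose t P Q := odflt z [pick u in (P :&: Q) :\: K].
pose f P Q := z |: (P :&: Q); pose g P Q := z |: (Q :\ t P Q).
have KLz : K \subset L :\ z by rewrite subsetD1 KL.
have cLz : #|L :\ z| = k + a.+1 
  by have := cardsD1 z L; rewrite zL cL addnS add1n => -[<-].
apply: leq_trans (edge_bound_rec a b) _.
rewrite (level_split K L k z).
apply: leq_trans _ (hampaths_splice Y (f := f) (g := g) (c := edge_bound a.+1 b) _ _ _).
- apply: leq_mul => //; apply: leq_mul.
    by apply: IHa => //; apply/levelP; split; rewrite // subsetD1 ?sXL ?sYL.
  (* There are ['C(a.+1 + b.+2, b.+2)] sets avoiding [z], hence at least [a.+1 * b.+2] edges in the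
     outer path. *)
  have := card_level (b := b.+2) (a := a.+1) KLz; rewrite -kE => -> //.
    by rewrite -ltnS prednK ?bin_addn_lower // (leq_trans _ (bin_addn_lower _ _)).
- rewrite -setI_eq0; apply/eqP/setP=> B; rewrite !inE subsetD1 subUset sub1set.
  by case: (z \in B); rewrite ?andbF.
- by apply/levelP; split; rewrite // subsetD1 sXL.
move=> P Q /levelP[KP PL cP] /levelP[KQ QL cQ]; rewrite (exchangeE cP cQ) => /eqP cPQ.
move: PL QL; rewrite !subsetD1 => /andP[PL zP] /andP[QL zQ].
have [tP tQ tK] : [/\ t P Q \in P, t P Q \in Q & t P Q \notin K].
  rewrite /t; case: pickP => [u|no] /=.
    by rewrite !inE => /andP[-> /andP[]].
  have /eqP : #|(P :&: Q) :\: K| = 0 by apply: eq_card0 => u; apply: no.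
  rewrite cardsD (setIidPr (_ : K \subset P :&: Q)) ?subsetI ?KP // subn_eq0.
  by rewrite -ltnS cPQ kE !addnS !ltnS -ltn_subRL subnn.
have tz : t P Q != z by apply: contraNneq zP => <-.
have cf : #|f P Q| = k by rewrite cardsU1 !inE (negPf zP) add1n.
have cg : #|g P Q| = k.
  by rewrite cardsU1 !inE (negPf zQ) andbF -cQ [RHS](cardsD1 (t P Q)) tQ.
have fL : f P Q \in level (z |: K) L k.
  apply/levelP; split=> //; first by rewrite setUS // subsetI KP.
  by rewrite subUset sub1set zL subIset ?PL.
have gL : g P Q \in level (z |: K) L k.
  apply/levelP; split=> //; first by rewrite setUS // subsetD1 KQ.
  by rewrite subUset sub1set zL (subset_trans _ QL) ?subsetDl.
have efg : exchange (f P Q) (g P Q).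
  rewrite (exchangeE cf cg).
  (* The common part is [z] with the [k - 2] elements of [P :&: Q] other than [t P Q]. *)
  have -> : f P Q :&: g P Q = z |: ((P :&: Q) :\ t P Q).
    apply/setP=> u; rewrite !inE.
    by case: (u == z); case: (u == t P Q); case: (u \in P); case: (u \in Q).
  rewrite cardsU1 !inE (negPf zP) andbF /= -cPQ.
  by rewrite (cardsD1 (t P Q) (P :&: Q)) inE tP tQ.
split=> //.
- rewrite (exchangeE cP cf); have -> : P :&: f P Q = P :&: Q; last exact/eqP.
  by rewrite /f setIUr setIA setIid (disjoint_setI0 _) ?set0U // disjoint_sym disjoints1.
- rewrite (exchangeE cg cQ); have -> : g P Q :&: Q = Q :\ t P Q.
    rewrite setIUl (disjoint_setI0 _) ?set0U ?disjoints1 //.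
    by apply/setIidPl; rewrite subsetDl.
  by rewrite -cQ [in X in _ == X](cardsD1 (t P Q)) tQ.
- apply: IHb => //; first by rewrite subUset sub1set zL.
  by rewrite cardsU1 zK kE add1n addSnnS.
Qed.
End Levels.

(** * From paths to Hamiltonian cycles *)

(** Carries the count from plain sets over to the subtype of bases: every entry of a path satisfies
    [P], so [insub] lifts the whole path. *)
Lemma hampaths_val (V : finType) (P : pred V) (S : subFinType P) (e : rel V) (x y : S) :
  size (hampaths e [set v | P v] (val x) (val y))
    <= size (hampaths (relpre val e) [set: S] x y).
Proof.
rewrite -(size_map (map val)); apply: uniq_leq_size; first exact: hampaths_uniq.
have Px : val x \in [set v | P v] by rewrite inE valP.
move=> p /(hampathsP _ _ _ Px)[up pP ep lp].
have pE : p = map val (pmap (insub : V -> option S) p).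
  rewrite (pmap_filter (insubK _)); apply/esym/all_filterP/allP=> v vp.
  have : v \in val x :: p by rewrite inE vp orbT.
  by rewrite pP inE isSome_insub.
move: up pP ep lp; rewrite pE; move: (pmap _ _) => q.
rewrite -(map_cons val x q) (map_inj_uniq val_inj) path_map last_map.
move=> uq qP eq lq; apply/map_f/hampathsP; rewrite ?inE //; split=> //.
- by move=> v; rewrite -(mem_map val_inj) qP !inE valP.
- exact: val_inj.
Qed.

Section CycleEdges.
Variable T : finType.

Lemma next_last (x : T) (p : seq T) : uniq (x :: p) -> next (x :: p) (last x p) = x.
Proof.
by move=> up; have := cycle_next up; rewrite /= rcons_path => /andP[_ /eqP].
Qed.

(** Once [u] is rotated to the front, its second successor is the third entry. *)
Lemma next_next_neq (s : seq T) (u : T) :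
  uniq s -> 2 < size s -> u \in s -> next s (next s u) != u.
Proof.
move=> us s3 /rot_to[i s' def_s]; rewrite -!(next_rot i us) def_s.
have := s3; rewrite -(size_rot i) def_s; have := us; rewrite -(rot_uniq i) def_s.
case: s' {def_s} => [|v [|w s']] //= /andP[]; rewrite !inE !negb_or.
move=> /and3P[uv uw _] _ _; rewrite eqxx [v == u]eq_sym (negPf uv) eqxx.
by rewrite eq_sym.
Qed.

(* Following the cycle from [y] to [x] fixes an orientation, and then the two
   neighbours of a vertex determine its successor once its predecessor is
   known. *)
Lemma cycle_edges_inj (x y : T) (p q : seq T) :
    uniq (x :: p) -> uniq (x :: q) -> x :: p =i x :: q -> 2 < size (x :: p) ->
    last x p = y -> last x q = y ->
  cycle_edges (x :: p) = cycle_edges (x :: q) -> p = q.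
Proof.
move=> up uq pq p3 lp lq ce.
have xp := next_last up; have xq := next_last uq; rewrite lp in xp; rewrite lq in xq.
have ys : y \in x :: p by rewrite -lp mem_last.
move Ds: (x :: p) up p3 xp ce pq ys => s up p3 xp ce pq ys.
move Dt: (x :: q) uq xq ce pq => t uq xq ce pq.
have ns u : u \in s -> next s u != u.
  move=> us; apply: contraNneq (next_next_neq up p3 us) => E.
  by rewrite E E.
(* The induction carries a vertex together with its successor, since the next step needs the
   predecessor. *)
have st i : [/\ iter i (next s) y \in s, iter i (next s) y = iter i (next t) y
              & iter i.+1 (next s) y = iter i.+1 (next t) y].
  elim: i => [|i [/= us <- vE]]; first by rewrite /= xp xq.
  set u := iter i (next s) y in us vE *; rewrite -vE; set v := next s u in vE *.
  have vs : v \in s by rewrite mem_next.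
  split=> //; have : [set v; next s v] \in cycle_edges t.
    by rewrite -ce; apply/imsetP; exists v.
  case/imsetP=> w _ /setP E; have := E v; rewrite !inE eqxx /= => /esym/orP[]/eqP wE.
    have := E (next s v).
    by rewrite -wE !inE eqxx orbT (negPf (ns v vs)) /= => /esym/eqP.
  (* Otherwise [t] uses this edge to enter [v], so it is the edge from [u] to [v], and [u] would be
     [v] or the second successor of [u] in [s]. *)
  have wu : w = u by apply: (can_inj (prev_next uq)); rewrite -wE.
  have := E u; rewrite wu !inE eqxx /= => /orP[]/eqP uE.
    by have := ns u us; rewrite -/v -uE eqxx.
  by have := next_next_neq up p3 us; rewrite -/v -uE eqxx.
have size_st : size s = size t by apply/eqP; rewrite eqn_leq !uniq_leq_size // => z; rewrite pq.
suff : s = t by rewrite -Ds -Dt => -[].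
apply: (@eq_from_nth _ x) => // i i_s.
(* Entry [i] comes [i + 1] steps after [y], because [y] is followed by the first entry [x]. *)
have iterE r : uniq (x :: r) -> next (x :: r) y = x -> i < size (x :: r) ->
    nth x (x :: r) i = iter i.+1 (next (x :: r)) y.
  move=> ur rE ir; rewrite iterSr rE.
  by rewrite [in LHS](fcycle_consE (cycle_next ur)) nth_traject.
have [_ _] := st i; rewrite -Ds -Dt -(iterE p) -?(iterE q) ?Ds ?Dt //.
by rewrite -size_st.
Qed.

End CycleEdges.

Lemma hampath_cycle (G : sgraph) (x y : G) (p : seq G) :
    adj x y -> p \in hampaths (@adj G) [set: G] x y ->
  cycle_edges (x :: p) \in [set C in hamiltonian_cycles G | [set x; y] \in C].
Proof.
move=> exy /(hampathsP _ _ _ (in_setT x))[up pG ep lp].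
rewrite inE; apply/andP; split.
  have sp : size (x :: p) == #|G|.
    by rewrite -(card_uniqP up); apply/eqP/eq_card=> z; rewrite pG !inE.
  apply/imsetP; exists (Tuple sp) => //=.
  by rewrite inE /ucycleb /= rcons_path ep lp adj_sym exy.
(* The step from [y] back to [x], which closes the path, is the prescribed edge. *)
apply/imsetP; exists y; first by rewrite -lp mem_last.
by have := next_last up; rewrite lp => ->; rewrite setUC.
Qed.

Lemma hampaths_hamiltonian_cycles (G : sgraph) (x y : G) :
    adj x y -> 2 < #|G| ->
  size (hampaths (@adj G) [set: G] x y)
    <= #|[set C in hamiltonian_cycles G | [set x; y] \in C]|.
Proof.
move=> exy G3; rewrite -(size_map (fun p => cycle_edges (x :: p))) cardE.
apply: uniq_leq_size => [|_ /mapP[p pH ->]]; last first.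
  by rewrite mem_enum hampath_cycle.
rewrite map_inj_in_uniq ?hampaths_uniq // => p q pH qH.
have [up pG _ lp] := hampathsP _ _ _ (in_setT x) pH.
have [uq qG _ lq] := hampathsP _ _ _ (in_setT x) qH.
apply: (cycle_edges_inj up uq _ _ lp lq) => [z|]; first by rewrite pG qG.
by rewrite /= -(hampaths_size (in_setT x) pH) cardsT.
Qed.

(** * The bound for uniform matroids *)

Unset Implicit Arguments.

Theorem theorem3p7 (n r : nat) (r_ge1 : 1 <= r) (lt_rn : r < n)
    (e : {set basis_graph (uniform_matroid (ltnW lt_rn))}) :
  e \in edges (basis_graph (uniform_matroid (ltnW lt_rn))) ->
  ((n - r - 1)`! * (r - 1)`!) ^ minn (n - r - 1) (r - 1)
    <= #|[set C in hamiltonian_cycles (basis_graph (uniform_matroid (ltnW lt_rn)))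
          | e \in C]|.
Proof.
case/imsetP=> -[x y]; rewrite inE /= => exy -> {e}.
set G := basis_graph _ in x y exy *; have {}exy : adj x y := exy.
have paths : edge_bound (n - r - 1) (r - 1) <= size (hampaths (@adj G) [set: G] x y).
  apply: leq_trans (hampaths_val (@exchange _) x y).
  have -> : [set B | B \in bases (uniform_matroid (ltnW lt_rn))] = level set0 [set: 'I_n] r.
    by apply/setP=> B; rewrite !inE sub0set subsetT.
  have xr (z : G) : val z \in level set0 [set: 'I_n] r.
    by have := valP z; rewrite !inE sub0set subsetT.
  (* Here [K] is empty, [L] is the whole ground set, [a = n - r - 1] and [b = r - 1]. *)
  apply: level_hampaths => //; rewrite ?sub0set ?cards0 ?cardsT ?card_ord; lia.
have [n2|n_le2] := ltnP 2 n.
  apply: leq_trans paths _; apply: hampaths_hamiltonian_cycles => //.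
  rewrite card_sig (eq_card (B := [set B : {set 'I_n} | #|B| == r])); last first.
    by move=> B; rewrite !inE.
  rewrite card_draws card_ord -(subnK (ltnW lt_rn)).
  (* ['C(n, r) > (n - r) * r >= n - 1 >= 2]. *)
  apply: leq_trans (bin_addn_lower _ _); nia.
(* Now [n = 2] and [r = 1]: the bound is 1, and closing a single path suffices. *)
have -> : minn (n - r - 1) (r - 1) = 0 by lia.
move: paths; rewrite expn0 /edge_bound.
have -> : minn (n - r - 1) (r - 1) = 0 by lia.
rewrite expn0 card_gt0.
case E: hampaths => [//|p P] _; apply/set0Pn; exists (cycle_edges (x :: p)).
have pH : p \in hampaths (@adj G) [set: G] x y by rewrite E mem_head.
exact: (hampath_cycle exy pH).
Qed.
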